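(* Let $n\ge4$. If the exponents $p_1,\dots,p_n,r$ satisfy $$1<p_1,\dots,p_n<\infty,\qquad r^{-1}=\sum_{1\le i\le n}p_i^{-1},\qquad 3p_1^{-1}+p_2^{-1}+p_3^{-1}>4,$$ then there is no finite constant $C$ such that the inequality $$\bigg\|\mathrm{p.v.}\int_{\mathbb R}\prod_{1\le i\le n}f_i(x-t^i)\,\frac{dt}{t}\bigg\|_{L^r_x(\mathbb R)}\le C\prod_{1\le i\le n}\|f_i\|_{L^{p_i}(\mathbb R)}$$ holds for all functions $f_i\in L^{p_i}(\mathbb R)$, $1\le i\le n$.
   Context: For $0<r<1$, $\|f\|_{L^r}=(\int|f|^r)^{1/r}$. The principal value is the limit as $\epsilon\to0^+$ of the integral over $|t|>\epsilon$. *)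

(* Defs.v *)
Set Warnings "-notation-overridden,-ambiguous-paths".
From mathcomp Require Export all_boot all_order all_algebra.
From mathcomp Require Export all_classical all_reals all_analysis.
Export numFieldNormedType.Exports.

Set Implicit Arguments.
Unset Strict Implicit.
Unset Printing Implicit Defensive.
Import Order.TTheory GRing.Theory Num.Theory.

Local Open Scope classical_set_scope.
Local Open Scope ring_scope.

Section PrincipalValue.
Variable R : realType.
Notation mu := (@lebesgue_measure R).

Definition truncated_integral (g : R -> R) (e : R) : R :=
  Rintegral mu [set t | e < `|t|] g.

(* [Rintegral] and [lim] are total, with a junk value when the integral or the
   limit does not exist; [pv_exists g] asserts that [pv g] is meaningful. *)
Definition pv (g : R -> R) : R := lim (truncated_integral g e @[e --> 0^'+]).

Definition pv_exists (g : R -> R) : Prop :=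
  (forall e : R, 0 < e ->
     mu.-integrable [set t | e < `|t|] (fun t => (g t)%:E)) /\
  cvg (truncated_integral g e @[e --> 0^'+]).

End PrincipalValue.

(* Families are indexed by the natural numbers 1, ..., n; the functions f i with
   i outside this range play no role. *)
Definition moment_integrand (R : realType) (n : nat) (f : nat -> R -> R)
    (x t : R) : R :=
  (\prod_(1 <= i < n.+1) f i (x - t ^+ i)) / t.

(* Main.v *)
Require Import Defs.
From mathcomp Require Import measurable_realfun ring lra zify.
Import Order.TTheory GRing.Theory Num.Theory.

(** The inequality is tested on indicators [f i = \1_(E i)] at a scale [e = 1 / N]
    tending to [0], with [x] and [t] of size [e].

    The sets [E 2] and [E 3] are made of intervals of radius about [e ^+ 6]
    around the values of [u - u ^+ 2] and of [u - u ^+ 3] at the same nodes [u],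
    which run through [[e, 2 e]] and slightly beyond, and [E 1] is a comb of [N] teeth, spaced by
    [e ^+ 4] and about [e ^+ 5] wide. Suppose that [x - t ^+ 3] is near
    [u - u ^+ 3] and that [x - t] is near the [j]-th tooth [- j e ^+ 4]. Then
    [t] is near [u + j e ^+ 4] and [x] is near [u + 3 u ^+ 2 j e ^+ 4], so
    that [x - t ^+ 2] differs from [u - u ^+ 2] by about
    [- j e ^+ 4 (2 u - 3 u ^+ 2)]. On the curve [u - u ^+ 2], whose slope is
    [1 - 2 u], this amounts to lowering [u] by
    [j e ^+ 4 (2 u - 3 u ^+ 2) / (1 - 2 u)], that is, by
    [j e ^+ 4 (2 u + u ^+ 2)] up to an admissible error. If consecutive nodes
    are [e ^+ 4 (2 u + u ^+ 2)] apart, the lowered point is again a node, and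
    [x - t ^+ 2] lies in [E 2]: the condition on [x - t ^+ 2] costs nothing
    once the other two hold ([quadratic_drift], [cubic_drift]). Meanwhile, as
    [j] varies, the points [u + 3 u ^+ 2 j e ^+ 4] fill the gap between two
    consecutive nodes with mesh about [e ^+ 6]. Hence a positive proportion of
    the [x] in [[e, 2 e]] have an interval of good [t] of length [e ^+ 5]
    ([window_hits]). For [i >= 4] the set [E i] is the interval [[0, 2 e]],
    which contains [x - t ^+ i] automatically.

    Whenever [x - t] is in [E 1] and [x - t ^+ 2] in [E 2], the difference
    [t - t ^+ 2] is at least [e / 4]; so [t] lies in [[e / 4, 1]], and the
    principal value is the integral of a nonnegative bounded function. It is
    at least [e ^+ 5 / (3 e)] on a set of measure [e / 2]
    ([pv_test_fun_ge], [measure_windows]).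

    The measures of [E 1], [E 2], [E 3] and [E i] ([i >= 4]) are of orders
    [e ^+ 4], [e ^+ 2], [e ^+ 2] and [e] ([measure_test_set]). With
    [rho = \sum_i (p i)^-1], the inequality would bound [e ^+ 4 * e `^ rho] by
    a constant multiple of [e `^ (rho + 3 / p 1 + 1 / p 2 + 1 / p 3)], that is,
    bound [1] by a constant multiple of a positive power of [e]. *)

Set Implicit Arguments.
Unset Strict Implicit.
Unset Printing Implicit Defensive.

Local Open Scope classical_set_scope.
Local Open Scope ring_scope.

(** * Principal values of indicators of sets away from the origin *)

Section PositiveKernel.
Variable R : realType.
Notation mu := (@lebesgue_measure R).
Implicit Types (S : set R) (a b : R).

Lemma measure_itvcc a b : a <= b -> mu `[a, b] = (b - a)%:E.
Proof.
rewrite lebesgue_measure_itv /= lte_fin.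
by case: ltgtP => // -> _; rewrite subrr.
Qed.

Lemma measure_itvco a b : a <= b -> mu `[a, b[ = (b - a)%:E.
Proof.
rewrite lebesgue_measure_itv /= lte_fin.
by case: ltgtP => // -> _; rewrite subrr.
Qed.

Lemma integrable_indic_inv S a b :
    measurable S -> 0 < a -> S `<=` `[a, b] ->
  mu.-integrable setT (fun t => (\1_S t / t)%:E).
Proof.
move=> mS a0 Sab.
have -> : (fun t => (\1_S t / t)%:E) = ((EFin \o @GRing.inv R) \_ S)%E.
  by apply/funext => t; rewrite indicE patchE; case: ifPn => _; rewrite ?mul1r ?mul0r.
refine ((integrable_mkcond (mu:=mu) (EFin \o @GRing.inv R) mS).1 _).
have S0 t : S t -> 0 < t.
  by move/Sab => /=; rewrite in_itv /= => /andP[+ _]; exact: lt_le_trans.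
have mab : (mu S < +oo)%E.
  apply: (@le_lt_trans _ _ (mu `[a, b])); first by apply: le_measure; rewrite ?inE.
  by rewrite lebesgue_measure_itv /=; case: ifP => // _; rewrite -EFinB ltry.
apply: measurable_bounded_integrable => //.
  apply: (@measurable_funS _ _ _ _ (`]0, +oo[%classic : set R) S) => //.
    by move=> t /S0 /=; rewrite in_itv /= andbT.
  apply: open_continuous_measurable_fun; first exact: interval_open.
  move=> t; rewrite inE /= in_itv /= andbT => t0.
  by apply: inv_continuous; rewrite gt_eqF.
exists a^-1; split; first exact: num_real.
move=> M aM t St; have t0 := S0 t St.
rewrite /= normfV gtr0_norm //; apply: le_trans (ltW aM).
rewrite lef_pV2 ?posrE //.
by move: (Sab t St) => /=; rewrite in_itv /= => /andP[].
Qed.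

(** Removing a neighbourhood of the origin disjoint from [S] changes nothing, so
    the truncated integrals are eventually constant. *)
Lemma truncated_integral_indic_inv S a b e :
    S `<=` `[a, b] -> 0 < e < a ->
  truncated_integral (fun t => \1_S t / t) e = Rintegral mu setT (fun t => \1_S t / t).
Proof.
move=> Sab /andP[e0 ea].
rewrite /truncated_integral [LHS]Rintegral_mkcond; apply: eq_Rintegral => t _.
rewrite patchE indicE; case: ifPn => //; rewrite notin_setE /= => et.
case: (boolP (t \in S)); last by rewrite mul0r.
rewrite inE => /Sab /=; rewrite in_itv /= => /andP[at_ _]; exfalso; apply: et.
by rewrite (lt_le_trans ea) // (le_trans at_) // ler_norm.
Qed.

Lemma cvg_truncated_integral_indic_inv S a b : 0 < a -> S `<=` `[a, b] ->
  truncated_integral (fun t => \1_S t / t) e @[e --> 0^'+] -->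
  Rintegral mu setT (fun t => \1_S t / t).
Proof.
move=> a0 Sab; apply: cvg_near_cst; near=> e.
apply: (@truncated_integral_indic_inv S a b) => //.
by apply/andP; split; near: e; [exact: nbhs_right_gt|exact: nbhs_right_lt].
Unshelve. all: by end_near.
Qed.

Lemma pv_exists_indic_inv S a b : measurable S -> 0 < a -> S `<=` `[a, b] ->
  pv_exists (fun t => \1_S t / t).
Proof.
move=> mS a0 Sab; split=> [e e0|]; last first.
  exact: cvgP (cvg_truncated_integral_indic_inv a0 Sab).
apply: (integrableS measurableT) => //; last exact: integrable_indic_inv a0 Sab.
apply: open_measurable; rewrite (_ : [set t | _] = (fun t : R => `|t|) @^-1` `]e, +oo[).
  apply: open_comp; last exact: interval_open.
  by move=> t _; exact: norm_continuous.
by apply/seteqP; split=> t /=; rewrite in_itv /= andbT.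
Qed.

Lemma pv_indic_invE S a b : 0 < a -> S `<=` `[a, b] ->
  pv (fun t => \1_S t / t) = Rintegral mu setT (fun t => \1_S t / t).
Proof. by move=> a0 Sab; apply/cvg_lim => //; exact: cvg_truncated_integral_indic_inv a0 Sab. Qed.

(** The integrand [\1_S t / t] is nonnegative because [S] lies to the right of
    [a > 0], and it is at least [1 / d] on [[c, d]]. *)
Lemma le_pv_indic_inv S a b c d :
    measurable S -> 0 < a -> S `<=` `[a, b] ->
    0 < c -> c <= d -> `[c, d] `<=` S ->
  (d - c) / d <= pv (fun t => \1_S t / t).
Proof.
move=> mS a0 Sab c0 cd cdS; rewrite (pv_indic_invE a0 Sab).
have mcd : measurable (`[c, d]%classic : set R) by [].
have d0 : (0 <= (d^-1)%:E)%E.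
  by rewrite lee_fin invr_ge0; exact: le_trans (ltW c0) cd.
have -> : (d - c) / d = Rintegral mu setT (fun t => d^-1 * \1_`[c, d] t).
  rewrite /Rintegral (_ : (fun t => _) = (fun t => d^-1%:E * (\1_`[c, d] t)%:E)%E) //.
  rewrite ge0_integralZl //.
  - rewrite integral_indic // setIT.
    transitivity (fine (d^-1%:E * (d - c)%:E)%E); first by rewrite /= mulrC.
    by congr (fine (_ * _)%E); exact/esym/measure_itvcc.
  - by apply/measurable_EFinP; exact: measurable_indic.
apply: le_Rintegral => //.
- apply: (@eq_integrable _ _ _ mu setT measurableT (fun t => d^-1%:E * (\1_`[c, d] t)%:E)%E) => //.
  by apply: integrableZl => //; exact: integrable_indic_itv.
- exact: integrable_indic_inv a0 Sab.
move=> t _; rewrite !indicE.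
case: (boolP (t \in `[c, d]%classic)) => [|_]; last first.
  rewrite mulr0; case: (boolP (t \in S)); rewrite ?mul0r // inE => /Sab /=.
  by rewrite in_itv /= => /andP[at_ _]; rewrite mul1r invr_ge0 ltW // (lt_le_trans a0).
rewrite inE => tcd; have tS := cdS t tcd; rewrite mem_set // mulr1 mul1r.
move: tcd; rewrite /= in_itv /= => /andP[ct td].
by rewrite lef_pV2 ?posrE // (lt_le_trans c0) // (le_trans ct).
Qed.

End PositiveKernel.

(** * Products and norms of indicators *)

Section Indicators.
Variable R : realType.
Notation mu := (@lebesgue_measure R).
Implicit Types (E : nat -> set R).

(** The support of the integrand at [x] when the functions are indicators of the
    sets [E i]. *)
Definition hitting_times n E x : set R :=
  [set t | forall i, (1 <= i <= n)%N -> E i (x - t ^+ i)].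

Lemma measurable_hitting_times n E x :
  (forall i, (1 <= i <= n)%N -> measurable (E i)) -> measurable (hitting_times n E x).
Proof.
move=> mE.
have -> : hitting_times n E x =
    \bigcap_(i in [set i | (1 <= i <= n)%N]) ((fun t => x - t ^+ i) @^-1` E i).
  by [].
apply: bigcap_measurableType => i /= ni.
rewrite -[X in measurable X]setTI.
apply: (continuous_measurable_fun (R := R)) => //; last exact: mE.
by move=> t; apply: cvgB; [exact: cvg_cst | exact: exprn_continuous].
Qed.

Lemma moment_integrand_indic n E x :
  moment_integrand n (fun i => \1_(E i)) x = (fun t => \1_(hitting_times n E x) t / t).
Proof.
apply/funext => t; rewrite /moment_integrand; congr (_ / _).
rewrite [RHS]indicE; case: (boolP (t \in _)).
  rewrite inE => tE; rewrite big_nat big1 // => i /tE iE.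
  by rewrite indicE mem_set.
move=> tE; have [i ni iE] : exists2 i, (1 <= i <= n)%N & ~ E i (x - t ^+ i).
  apply: contrapT => h; move: tE; rewrite notin_setE; apply=> i ni.
  by apply: contrapT => Ei; apply: h; exists i.
rewrite (bigD1_seq i) ?mem_index_iota ?iota_uniq //= indicE memNset //.
by rewrite mul0r.
Qed.

End Indicators.

Section LnormIndicators.
Context d (T : measurableType d) (R : realType) (mu : {measure set T -> \bar R}).
Implicit Types A : set T.

Lemma Lnorm_indic (p : R) A : p != 0 -> measurable A ->
  'N[mu]_(p%:E)[(fun y => (\1_A y)%:E)]%E = (mu A `^ p^-1)%E.
Proof.
move=> p0 mA; rewrite unlock /=; congr (_ `^ _)%E.
rewrite -[A in RHS]setIT -integral_indic //; apply: eq_integral => y _.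
rewrite /= indicE; case: (_ \in _) => /=.
  by rewrite normr1 powR1.
by rewrite normr0 powR0.
Qed.

Lemma indic_Lfun (p : R) A : p != 0 -> measurable A -> (mu A < +oo)%E ->
  (\1_A : T -> R) \in Lfun mu p%:E.
Proof.
move=> p0 mA Aoo; apply/andP; split; rewrite inE /=.
  exact: measurable_indic.
by rewrite /finite_norm /= (Lnorm_indic p0 mA) poweR_lty.
Qed.

(** Chebyshev's inequality. The function [f] is arbitrary: its integral is a
    supremum over simple functions, and [c `^ p] times the indicator of [A] is
    one of them. This spares the measurability of a principal value in its
    parameter. *)
Lemma Lnorm_ge_indic (p c : R) (f : T -> R) A : 0 < p -> 0 < c -> measurable A ->
    (forall x, A x -> c <= f x) ->
  (c%:E * mu A `^ p^-1 <= 'N[mu]_(p%:E)[(fun x => (f x)%:E)])%E.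
Proof.
move=> p0 c0 mA cf; rewrite unlock /=.
have cp0 : 0 <= c `^ p by exact: powR_ge0.
have -> : (c%:E * mu A `^ p^-1)%E = (((c `^ p)%:E * mu A) `^ p^-1)%E.
  rewrite poweRM ?lee_fin // poweR_EFin -powRrM divff ?gt_eqF //.
  by rewrite powRr1 // ltW.
have p10 : 0 <= p^-1 by rewrite invr_ge0 ltW.
apply: (gt0_ler_poweR p10); rewrite ?in_itv /= ?leey ?andbT.
- by rewrite mule_ge0 // lee_fin.
- by apply: integral_ge0 => x _; rewrite lee_fin powR_ge0.
rewrite ge0_integralTE; last by move=> x; rewrite lee_fin powR_ge0.
apply: ereal_sup_ubound => /=.
exists (mul_nnsfun (cst_nnsfun T (NngNum cp0)) (indic_nnsfun R mA)).
  move=> x /=.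
  change (((c `^ p) * \1_A x)%:E <= (`|f x| `^ p)%:E)%E.
  rewrite lee_fin indicE; case: (boolP (x \in A)) => [|_]; last first.
    by rewrite mulr0 powR_ge0.
  rewrite inE => /cf cfx; rewrite mulr1; apply: ge0_ler_powR.
  - exact: ltW.
  - by rewrite nnegrE ltW.
  - by rewrite nnegrE normr_ge0.
  - exact: le_trans cfx (ler_norm _).
by rewrite sintegralrM sintegral_indic.
Qed.

End LnormIndicators.

(** * Polynomial drift estimates *)

Section Algebra.
Variable R : realType.
Implicit Types e s w q b g u v a c x y h : R.

Lemma exists_multiple h y : 0 < h -> 0 <= y ->
  exists m : nat, m%:R * h <= y < m.+1%:R * h.
Proof.
move=> h0 y0; exists (Num.truncn (y / h)).
rewrite -ler_pdivlMr // -ltr_pdivrMr //.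
by apply: truncn_itv; rewrite divr_ge0 // ltW.
Qed.

Lemma mulr_itv0 a c x y : 0 <= x <= a -> 0 <= y <= c -> 0 <= x * y <= a * c.
Proof.
move=> /andP[x0 xa] /andP[y0 yc]; rewrite mulr_ge0 //=.
exact: ler_pM.
Qed.

(** With [j e = q], the point [x = u + 3 u ^+ 2 (j e ^+ 4) + b e ^+ 6] and the time
    [t = u + j e ^+ 4 + g e ^+ 5] satisfy [x - t ^+ 2 = v - v ^+ 2] up to
    [O(e ^+ 6)], where [v] is [u] lowered by [j] steps. The step is computed at
    the start [e s] of the block containing [u], which is within [e ^+ 3] of [u];
    the terms of order [e ^+ 4] and [e ^+ 5] cancel exactly, and the proof
    writes the remainder as [e ^+ 6] times a bounded polynomial. *)
Lemma quadratic_drift e s w q b g u v :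
    0 < e <= 1 / 100 -> 1 <= s <= 2 -> 0 <= w <= 1 -> 0 <= q <= 1 ->
    0 <= b <= 13 -> 0 <= g <= 1 ->
    u = e * s + e ^+ 3 * w ->
    v = u - q * (e ^+ 4 * (2 * s + e * s ^+ 2)) ->
  `|(u + 3 * u ^+ 2 * (q * e ^+ 3) + b * e ^+ 6)
    - (u + q * e ^+ 3 + g * e ^+ 5) ^+ 2 - (v - v ^+ 2)| <= 40 * e ^+ 6.
Proof.
move=> e01 s12 w01 q01 b01 g01 uE vE; case/andP: (e01) => e0 e1.
have -> : (u + 3 * u ^+ 2 * (q * e ^+ 3) + b * e ^+ 6)
    - (u + q * e ^+ 3 + g * e ^+ 5) ^+ 2 - (v - v ^+ 2) =
  e ^+ 6 * (q * (- 2 * s ^+ 3 - 2 * w + 2 * e * s * w - 2 * e ^+ 2 * s ^+ 2 * w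
                 + 3 * e ^+ 3 * w ^+ 2)
    + (e * (q * (2 * s + e * s ^+ 2))) ^+ 2 + b - 2 * ((s + e ^+ 2 * w) * g)
    - (q + e ^+ 2 * g) ^+ 2).
  by rewrite vE uE; ring.
have e60 : 0 <= e ^+ 6 by rewrite exprn_ge0 // ltW.
rewrite normrM (ger0_norm e60) mulrC ler_wpM2r //.
have {}e01 : 0 <= e <= 1 / 100 by rewrite ltW.
have s02 : 0 <= s <= 2 by lra.
have e2 := mulr_itv0 e01 e01.
have s2 := mulr_itv0 s02 s02.
have s3 := mulr_itv0 s2 s02.
have sw := mulr_itv0 s02 w01.
have esw := mulr_itv0 e01 sw.
have w2 := mulr_itv0 w01 w01.
have e3 := mulr_itv0 e2 e01.
have e3w2 := mulr_itv0 e3 w2.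
have e2sw := mulr_itv0 e2 (mulr_itv0 s2 w01).
have es2 := mulr_itv0 e01 s2.
have e2g := mulr_itv0 e2 g01.
have e2w := mulr_itv0 e2 w01.
set Q := (X in q * X).
(* [Q <= 1] suffices and follows from [0 <= s ^+ 3]; the shift makes [1 - Q]
   nonnegative, as needed for the product with [q]. *)
have Q20 : 0 <= 1 - Q <= 21 by rewrite /Q; lra.
have qQ := mulr_itv0 q01 Q20.
have H5 : 0 <= 2 * s + e * s ^+ 2 <= 5 by lra.
have qH := mulr_itv0 e01 (mulr_itv0 q01 H5).
have qH2 := mulr_itv0 qH qH.
have D2 : 0 <= q + e ^+ 2 * g <= 2 by lra.
have D4 := mulr_itv0 D2 D2.
have S3 : 0 <= s + e ^+ 2 * w <= 3 by lra.
have Sg := mulr_itv0 S3 g01.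
rewrite ler_norml; rewrite -!expr2 in qH2 D4.
lra.
Qed.

(** The term [3 u ^+ 2 q e ^+ 3] of [x] is the first-order variation of [t ^+ 3]
    when [t] moves from [u] by [q e ^+ 3]; the second-order variation is already
    of order [e ^+ 7]. *)
Lemma cubic_drift e s w q b g u :
    0 < e <= 1 / 100 -> 1 <= s <= 2 -> 0 <= w <= 1 -> 0 <= q <= 1 ->
    0 <= b <= 13 -> 0 <= g <= 1 ->
    u = e * s + e ^+ 3 * w ->
  `|(u + 3 * u ^+ 2 * (q * e ^+ 3) + b * e ^+ 6)
    - (u + q * e ^+ 3 + g * e ^+ 5) ^+ 3 - (u - u ^+ 3)| <= 40 * e ^+ 6.
Proof.
move=> e01 s12 w01 q01 b01 g01 uE; case/andP: (e01) => e0 e1.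
have -> : (u + 3 * u ^+ 2 * (q * e ^+ 3) + b * e ^+ 6)
    - (u + q * e ^+ 3 + g * e ^+ 5) ^+ 3 - (u - u ^+ 3) =
  e ^+ 6 * (b - 3 * (e * ((s + e ^+ 2 * w) ^+ 2 * g))
    - 3 * (e * ((s + e ^+ 2 * w) * (q + e ^+ 2 * g) ^+ 2))
    - (e * (q + e ^+ 2 * g)) ^+ 3).
  by rewrite uE; ring.
have e60 : 0 <= e ^+ 6 by rewrite exprn_ge0 // ltW.
rewrite normrM (ger0_norm e60) mulrC ler_wpM2r //.
have {}e01 : 0 <= e <= 1 / 100 by rewrite ltW.
have e2 := mulr_itv0 e01 e01.
have e2g := mulr_itv0 e2 g01.
have e2w := mulr_itv0 e2 w01.
have D2 : 0 <= q + e ^+ 2 * g <= 2 by lra.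
have S3 : 0 <= s + e ^+ 2 * w <= 3 by lra.
have t1 := mulr_itv0 e01 (mulr_itv0 (mulr_itv0 S3 S3) g01).
have t2 := mulr_itv0 e01 (mulr_itv0 S3 (mulr_itv0 D2 D2)).
have eD := mulr_itv0 e01 D2.
have t3 := mulr_itv0 (mulr_itv0 eD eD) eD.
rewrite ler_norml.
lra.
Qed.

End Algebra.

Section ScaleBounds.
Variable R : realType.
Implicit Types e s w u t : R.

Lemma scale_expr3_le e : 0 < e <= 1 / 100 -> e ^+ 3 <= e * (1 / 100).
Proof.
move=> e1; rewrite (_ : e ^+ 3 = e * (e * e)); last by ring.
have e01 : 0 <= e <= 1 / 100 by lra.
rewrite ler_pM2l; last by lra.
have := mulr_itv0 e01 e01; lra.
Qed.

Lemma scale_expr5_le e : 0 < e <= 1 / 100 -> e ^+ 5 <= e * (1 / 100).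
Proof.
move=> e1; apply: le_trans (scale_expr3_le e1).
by apply: ler_wiXn2l => //; lra.
Qed.

Lemma scaled_point_le e s w u : 0 < e <= 1 / 100 -> 1 <= s <= 2 -> 0 <= w <= 1 ->
  u = e * s + e ^+ 3 * w -> u <= e * (2 + 1 / 100).
Proof.
move=> e1 s12 w01 ->.
have e3 := scale_expr3_le e1; have e30 : 0 <= e ^+ 3 by apply: exprn_ge0; lra.
have e3w : e ^+ 3 * w <= e ^+ 3 by rewrite ler_piMr //; lra.
have es : e * s <= e * 2 by rewrite ler_pM2l; lra.
lra.
Qed.

Lemma cubic_slope_le e u : 0 < e -> 0 <= u <= e * (2 + 1 / 100) ->
  3 * u ^+ 2 * e ^+ 4 <= 13 * e ^+ 6.
Proof.
move=> e0 u0; have /andP[_ uu] := mulr_itv0 u0 u0.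
have -> : 13 * e ^+ 6 = 13 * (e * e) * e ^+ 4 by ring.
rewrite ler_pM2r ?exprn_gt0 //; have : 0 < e * e by apply: mulr_gt0.
lra.
Qed.

Lemma higher_power_itv e x t k : 0 < e <= 1 / 100 -> e <= x <= 2 * e ->
  0 <= t <= e * 3 -> (2 <= k)%N -> 0 <= x - t ^+ k <= 2 * e.
Proof.
move=> e1 xe t0 k2.
have tk : t ^+ k <= t ^+ 2 by apply: ler_wiXn2l => //; lra.
have tk0 : 0 <= t ^+ k by apply: exprn_ge0; lra.
have := mulr_itv0 t0 t0; rewrite -expr2.
have -> : e * 3 * (e * 3) = e * (9 * e) by ring.
have : e * (9 * e) <= e * 1 by rewrite ler_pM2l; lra.
lra.
Qed.

End ScaleBounds.

(** * The test sets and their incidences *)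

Section Construction.
Variable R : realType.
Variables (e : R) (N : nat).

(** The nodes form arithmetic progressions on blocks of length [e ^+ 3], the step
    of a block being the desired spacing [e ^+ 4 (2 u + u ^+ 2)] at its left
    end. A block is long compared with the displacement of [j < N] steps,
    which is of order [e ^+ 4], and short enough for the variation of the
    spacing over it to be negligible. *)
Definition block_start (i : nat) : R := e + i%:R * e ^+ 3.
Definition node_step (i : nat) : R := e ^+ 4 * (2 * block_start i + block_start i ^+ 2).
Definition node (i m : nat) : R := block_start i + m%:R * node_step i.

Definition comb : set R :=
  \bigcup_(j in `I_N)
    `[- (j%:R * e ^+ 4) - 5 * e ^+ 5, - (j%:R * e ^+ 4) + 5 * e ^+ 5]%classic.

(** A block needs at most [N ^ 2 / 2] nodes, since its steps are at least
    [2 e ^+ 5]; the nodes of index up to [N ^ 2] run over into later blocks. *)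
Definition curve_nodes (k : nat) : set R :=
  \bigcup_(i in `I_(N ^ 2)) \bigcup_(m in `I_(N ^ 2))
    `[node i m - node i m ^+ k - 40 * e ^+ 6,
      node i m - node i m ^+ k + 40 * e ^+ 6]%classic.

(** The second halves of the blocks, so that every node just below [x] has at
    least [N] predecessors in its block. *)
Definition windows : set R :=
  \bigcup_(i in `I_(N ^ 2)) `[block_start i + e ^+ 3 / 2, block_start i + e ^+ 3[%classic.

Definition test_set (i : nat) : set R :=
  if i == 1%N then comb else
  if (i <= 3)%N then curve_nodes i else `[0, 2 * e]%classic.

Hypothesis N100 : (100 <= N)%N.
Hypothesis Ne : N%:R * e = 1.

Lemma scale_gt0 : 0 < e.
Proof.
have N0 : 0 < N%:R :> R by rewrite ltr0n; lia.
by rewrite -(pmulr_rgt0 _ N0) Ne.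
Qed.

Lemma scale_itv : 0 < e <= 1 / 100.
Proof.
rewrite scale_gt0 /=; have e0 := scale_gt0.
have : 100%:R <= N%:R :> R by rewrite ler_nat.
move=> N100R; have := ler_wpM2r (ltW e0) N100R; rewrite Ne; lra.
Qed.

Lemma scaled_index_itv (j : nat) : (j < N)%N -> 0 <= j%:R * e <= 1.
Proof.
move=> jN; have e0 := scale_gt0; rewrite mulr_ge0 ?ler0n ?(ltW e0) //=.
by rewrite -[leRHS]Ne ler_pM2r // ler_nat ltnW.
Qed.

Lemma block_start_itv (i : nat) : (i < N ^ 2)%N ->
  exists2 s, 1 <= s <= 2 & block_start i = e * s.
Proof.
move=> iN; have e0 := scale_gt0; exists (1 + i%:R * e ^+ 2); last by rewrite /block_start; ring.
have i1 : i%:R * e ^+ 2 <= 1.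
  rewrite -[leRHS](expr1n _ 2) -[in leRHS]Ne exprMn -natrX ler_pM2r ?exprn_gt0 //.
  by rewrite ler_nat ltnW.
have : 0 <= i%:R * e ^+ 2 by rewrite mulr_ge0 ?ler0n // exprn_ge0 // ltW.
lra.
Qed.

Lemma node_step_itv i : (i < N ^ 2)%N -> 2 * e ^+ 5 <= node_step i <= 5 * e ^+ 5.
Proof.
move=> iN; have [s s12 bE] := block_start_itv iN; rewrite /node_step bE.
have -> : e ^+ 4 * (2 * (e * s) + (e * s) ^+ 2) = e ^+ 5 * (2 * s + e * (s * s)) by ring.
have /andP[e0 e1] := scale_itv.
have e01 : 0 <= e <= 1 / 100 by rewrite ltW.
have s02 : 0 <= s <= 2 by lra.
have es := mulr_itv0 e01 (mulr_itv0 s02 s02).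
rewrite ![_ * e ^+ 5]mulrC !ler_pM2l ?exprn_gt0 //; lra.
Qed.

(** Given [x], the node [u] is the last one of the block below [x], and the tooth
    [j] is the last one with [u + 3 u ^+ 2 j e ^+ 4 <= x]. The gap above [u] is
    at most [e ^+ 4 (2 u + u ^+ 2)], less than [3 u ^+ 2 N e ^+ 4] because
    [u >= e = 1 / N]; this gives [j < N]. The witness for [E 2] is the
    node [j] places below [u]. *)
Lemma window_hits i x : (i < N ^ 2)%N ->
    block_start i + e ^+ 3 / 2 <= x < block_start i + e ^+ 3 ->
  exists c, [/\ e <= c, c + e ^+ 5 <= 3 * e &
    forall t, c <= t <= c + e ^+ 5 ->
      forall k, (1 <= k)%N -> test_set k (x - t ^+ k)].
Proof.
move=> iN /andP[xlo xhi].
have /andP[e0 e1] := scale_itv.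
have e01 : 0 <= e <= 1 / 100 by rewrite ltW.
have [s s12 bE] := block_start_itv iN.
have /andP[h2 h5] := node_step_itv iN.
have e30 : 0 < e ^+ 3 by rewrite exprn_gt0.
have e50 : 0 < e ^+ 5 by rewrite exprn_gt0.
have e60 : 0 < e ^+ 6 by rewrite exprn_gt0.
have h0 : 0 < node_step i by lra.
have [m /andP[mlo mhi]] : exists m : nat,
    m%:R * node_step i <= x - block_start i < m.+1%:R * node_step i.
  by apply: exists_multiple => //; lra.
(* Rescaled unknowns of order [1], in the form of the drift lemmas. *)
pose w := m%:R * node_step i / e ^+ 3.
have wE : m%:R * node_step i = e ^+ 3 * w by rewrite /w [RHS]mulrC divfK // gt_eqF.
have w01 : 0 <= w <= 1.
  rewrite /w ler_pdivrMr // mul1r; apply/andP; split; last by lra.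
  by apply: divr_ge0 (ltW e30); exact: mulr_ge0 (ler0n _ _) (ltW h0).
pose u := node i m.
have uE : u = e * s + e ^+ 3 * w by rewrite /u /node bE wE.
have eu : e <= u.
  have := ler_wpM2l (ltW e0) (proj1 (andP s12)).
  have := mulr_ge0 (ltW e30) (proj1 (andP w01)).
  rewrite uE; lra.
have mN : (m < N ^ 2)%N.
  rewrite ltnNge; apply/negP => Nm.
  have : (N ^ 2)%:R * (2 * e ^+ 5) <= m%:R * node_step i.
    by apply: ler_pM; rewrite ?ler0n ?ler_nat //; exact: mulr_ge0 (ler0n _ 2) (ltW e50).
  rewrite natrX; have -> : N%:R ^+ 2 * (2 * e ^+ 5) = (N%:R * e) ^+ 2 * (2 * e ^+ 3) by ring.
  by rewrite Ne expr1n; lra.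
pose d := 3 * u ^+ 2 * e ^+ 4.
have d0 : 0 < d by rewrite /d !mulr_gt0 ?exprn_gt0 //; lra.
have [j /andP[jlo jhi]] : exists j : nat, j%:R * d <= x - u < j.+1%:R * d.
  by apply: exists_multiple => //; rewrite /u /node; lra.
have jN : (j < N)%N.
  rewrite ltnNge; apply/negP => Nj.
  have Nd : N%:R * d <= x - u.
    by apply: le_trans jlo; rewrite ler_pM2r // ler_nat.
  have dE : N%:R * d = e ^+ 3 * (3 * u ^+ 2).
    by rewrite /d -[e ^+ 3]mul1r -[X in _ = X * _ * _]Ne; ring.
  have es0 : 0 < e * s by apply: mulr_gt0 => //; lra.
  have us : (e * s) ^+ 2 <= u ^+ 2.
    rewrite ler_pXn2r ?nnegrE ?(ltW es0) //; last by lra.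
    rewrite uE; have := mulr_ge0 (ltW e30) (proj1 (andP w01)); lra.
  have xu : x - u < node_step i by clear -mhi; rewrite /u /node; lra.
  have stepE : node_step i = e ^+ 3 * (e * (2 * (e * s) + (e * s) ^+ 2)).
    by rewrite /node_step bE; ring.
  have : e ^+ 3 * (3 * (e * s) ^+ 2) < e ^+ 3 * (e * (2 * (e * s) + (e * s) ^+ 2)).
    rewrite -stepE; apply: le_lt_trans xu; apply: le_trans Nd.
    by rewrite dE ler_pM2l // ler_pM2l.
  rewrite ltr_pM2l //.
  have -> : 3 * (e * s) ^+ 2 = e ^+ 2 * (s * (3 * s)) by ring.
  have -> : e * (2 * (e * s) + (e * s) ^+ 2) = e ^+ 2 * (s * (2 + e * s)) by ring.
  rewrite !ltr_pM2l ?exprn_gt0 //; last by lra.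
  have s02 : 0 <= s <= 2 by lra.
  have := mulr_itv0 e01 s02; clear -s12; lra.
have q01 := scaled_index_itv jN.
pose q := j%:R * e.
(* [j] steps have length at most [5 e ^+ 4], while [x] is at least [e ^+ 3 / 2]
   above the start of its block. *)
have jm : (j <= m)%N.
  rewrite leqNgt; apply/negP => mj.
  have mjh : m.+1%:R * node_step i <= j%:R * node_step i by rewrite ler_pM2r // ler_nat.
  have jh : j%:R * node_step i <= j%:R * (5 * e ^+ 5) by apply: ler_wpM2l; rewrite ?ler0n.
  have := mulr_itv0 q01 (mulr_itv0 e01 (_ : 0 <= e ^+ 3 <= e ^+ 3)).
  rewrite lexx ltW // => /(_ isT) /andP[_].
  have -> : j%:R * e * (e * e ^+ 3) = j%:R * e ^+ 5 by ring.
  lra.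
have u3 := scaled_point_le scale_itv s12 w01 uE.
pose b := (x - u - j%:R * d) / e ^+ 6.
have b01 : 0 <= b <= 13.
  rewrite -natr1 mulrDl mul1r in jhi.
  rewrite /b ler_pdivrMr //; apply/andP; split.
    by apply: divr_ge0 (ltW e60); rewrite subr_ge0.
  have : d <= 13 * e ^+ 6 by apply: cubic_slope_le => //; rewrite u3 (le_trans (ltW e0)).
  by apply: le_trans; rewrite ltW // ltrBlDl.
have xE : x = u + 3 * u ^+ 2 * (q * e ^+ 3) + b * e ^+ 6.
  by rewrite /b divfK ?gt_eqF // /d /q; ring.
have qe : 0 <= q * e ^+ 3 <= e ^+ 3.
  have := mulr_itv0 q01 (_ : 0 <= e ^+ 3 <= e ^+ 3).
  by rewrite lexx (ltW e30) mul1r => /(_ isT).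
have e3_le := scale_expr3_le scale_itv; have e5_le := scale_expr5_le scale_itv.
have c0 : e <= u + q * e ^+ 3 by clear -eu qe; lra.
have c3 : u + q * e ^+ 3 + e ^+ 5 <= 3 * e by clear -u3 qe e3_le e5_le e0; lra.
exists (u + q * e ^+ 3); split => // t tc k k1.
pose g := (t - (u + q * e ^+ 3)) / e ^+ 5.
have g01 : 0 <= g <= 1.
  rewrite /g ler_pdivrMr // mul1r; clear -tc e50; apply/andP; split; last by lra.
  by apply: divr_ge0 (ltW e50); lra.
have tE : t = u + q * e ^+ 3 + g * e ^+ 5 by rewrite /g divfK ?gt_eqF //; ring.
rewrite /test_set; case: eqP => [->|k1'].
  exists j => //=; rewrite in_itv /= expr1.
  have -> : j%:R * e ^+ 4 = q * e ^+ 3 by rewrite /q; ring.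
  have xu : x - u < node_step i by clear -mhi; rewrite /u /node; lra.
  have : 0 <= j%:R * d by apply: mulr_ge0 (ler0n _ _) (ltW d0).
  clear -xu h5 jlo tc; lra.
case: ifP => k3.
  have [->|->] : k = 2%N \/ k = 3%N by clear -k1 k1' k3; lia.
  - exists i => //; exists (m - j)%N => /=; first exact: leq_ltn_trans (leq_subr j m) mN.
    have vE : node i (m - j) = u - q * (e ^+ 4 * (2 * s + e * s ^+ 2)).
      rewrite /u /node natrB // /node_step bE /q; ring.
    have := quadratic_drift scale_itv s12 w01 q01 b01 g01 uE vE.
    rewrite -xE -tE in_itv /= ler_norml; clear; lra.
  - exists i => //; exists m => //=.
    have := cubic_drift scale_itv s12 w01 q01 b01 g01 uE.
    rewrite -xE -tE in_itv /= ler_norml -/u; clear; lra.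
rewrite /= in_itv /=.
apply: higher_power_itv scale_itv _ _ _; [| |by clear -k1 k1'; lia].
  rewrite (le_trans eu) /=; last first.
    by rewrite -subr_ge0; apply: le_trans jlo; apply: mulr_ge0 (ler0n _ _) (ltW d0).
  apply: (le_trans (ltW xhi)); rewrite /block_start.
  have : i.+1%:R * e ^+ 3 <= (N ^ 2)%:R * e ^+ 3 by rewrite ler_pM2r // ler_nat.
  rewrite natrX (_ : N%:R ^+ 2 * e ^+ 3 = (N%:R * e) ^+ 2 * e); last by ring.
  by rewrite Ne expr1n mul1r -natr1 mulrDl mul1r; lra.
clear -tc c0 c3 e0; lra.
Qed.

End Construction.

(** * Sizes of the test sets and the lower bound *)

Section FiniteUnions.
Context d (T : measurableType d) (R : realType) (mu : {measure set T -> \bar R}).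

Lemma le_measure_finite_union (F : nat -> set T) (n : nat) (c : R) :
    (forall k, (k < n)%N -> measurable (F k)) ->
    (forall k, (k < n)%N -> (mu (F k) <= c%:E)%E) ->
  (mu (\bigcup_(k in `I_n) F k) <= (n%:R * c)%:E)%E.
Proof.
move=> mF Fc.
have FU : \bigcup_(k in `I_n) F k `<=` \big[setU/set0]_(k < n) F k.
  by rewrite bigcup_mkord.
have := @content_subadditive _ _ _ mu _ F n mF (fin_bigcup_measurable (finite_II n) mF) FU.
move=> /le_trans; apply.
apply: (@le_trans _ _ (\sum_(k < n) c%:E)%E).
  by apply: lee_sum => k _; exact: Fc.
by rewrite sumEFin sumr_const card_ord mulr_natl.
Qed.

Lemma measure_disjoint_union (F : nat -> set T) (n : nat) (c : R) :
    (forall k, measurable (F k)) -> trivIset setT F ->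
    (forall k, mu (F k) = c%:E) ->
  mu (\bigcup_(k in `I_n) F k) = (n%:R * c)%:E.
Proof.
move=> mF tF Fc; rewrite bigcup_mkord measure_bigsetU //.
rewrite (eq_bigr (fun=> c%:E)) => [|k _]; last exact: Fc.
by rewrite sumEFin sumr_const card_ord mulr_natl.
Qed.

End FiniteUnions.

Section TestSets.
Variable R : realType.
Variables (e : R) (N : nat).
Hypothesis N100 : (100 <= N)%N.
Hypothesis Ne : N%:R * e = 1.
Notation mu := (@lebesgue_measure R).
Notation E := (test_set e N).
Notation F := (windows e N).

Lemma measurable_test_set i : measurable (E i).
Proof.
rewrite /test_set; case: ifP => _; [|case: ifP => _ //].
  by apply: fin_bigcup_measurable.
by apply: fin_bigcup_measurable => // j _; exact: fin_bigcup_measurable.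
Qed.

Lemma measurable_windows : measurable F.
Proof. by apply: fin_bigcup_measurable. Qed.

(** The measure of [E i] is of order [e ^+ weight i]. *)
Definition weight (i : nat) : nat := if i == 1%N then 4 else if (i <= 3)%N then 2 else 1.

Lemma measure_test_set i : (mu (E i) <= (80 * e ^+ weight i)%:E)%E.
Proof.
have e0 := scale_gt0 N100 Ne.
rewrite /test_set /weight; case: ifP => _; [|case: ifP => _].
- apply: le_trans (le_measure_finite_union (c := 10 * e ^+ 5) _ _) _ => //.
    move=> j _; rewrite [leLHS](_ : _ = (10 * e ^+ 5)%:E) //.
    apply: etrans (measure_itvcc _) _; first by have := exprn_gt0 5 e0; lra.
    by congr EFin; ring.
  rewrite lee_fin (_ : _ * _ = 10 * (N%:R * e) * e ^+ 4); last by ring.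
  by rewrite Ne; have := exprn_gt0 4 e0; lra.
- have inner i' : (mu (\bigcup_(m in `I_(N ^ 2))
      `[(node e i' m - node e i' m ^+ i - 40 * e ^+ 6)%R,
        (node e i' m - node e i' m ^+ i + 40 * e ^+ 6)%R]%classic)
      <= ((N ^ 2)%:R * (80 * e ^+ 6))%:E)%E.
    apply: le_measure_finite_union => // m _.
    rewrite [leLHS](_ : _ = (80 * e ^+ 6)%:E) //.
    apply: etrans (measure_itvcc _) _; first by have := exprn_gt0 6 e0; lra.
    by congr EFin; ring.
  apply: le_trans (le_measure_finite_union _ _) _.
  + by move=> k _; exact: fin_bigcup_measurable.
  + by move=> k _; exact: inner.
  rewrite lee_fin natrX (_ : _ * _ = 80 * (N%:R * e) ^+ 4 * e ^+ 2); last by ring.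
  by rewrite Ne; lra.
rewrite measure_itvcc ?lee_fin; first by rewrite expr1; lra.
by apply: mulr_ge0 => //; exact: ltW.
Qed.

Lemma measure_windows : mu F = (e / 2)%:E.
Proof.
have e0 := scale_gt0 N100 Ne.
have e3 := exprn_gt0 3 e0.
apply: (etrans (@measure_disjoint_union _ _ _ mu _ _ (e ^+ 3 / 2) _ _ _)) => //.
- apply: ltn_trivIset => j i ij; apply/seteqP; split => // x [].
  rewrite /= !in_itv /= => /andP[x1 x2] /andP[x3 x4].
  have : i.+1%:R <= j%:R :> R by rewrite ler_nat.
  rewrite -natr1 => /(ler_wpM2r (ltW e3)).
  by move: x1 x2 x3 x4; rewrite /block_start; lra.
- move=> i; apply: etrans (measure_itvco _) _; first by lra.
  by congr EFin; lra.
congr EFin; rewrite natrX (_ : _ * _ = (N%:R * e) ^+ 2 * (e / 2)); last by ring.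
by rewrite Ne expr1n mul1r.
Qed.

(** [t - t ^+ 2] is the difference of a point of [E 2], which is at least about
    [e], and a point of [E 1], which is at most [5 e ^+ 5]. Its positivity also
    forces [t < 1]. *)
Lemma hitting_times_itv n x : (2 <= n)%N ->
  hitting_times n E x `<=` `[e / 4, 1].
Proof.
move=> n2 t tx.
have /andP[e0 e1] := scale_itv N100 Ne.
have e01 : 0 <= e <= 1 / 100 by rewrite ltW.
have [j _] := tx 1%N (ltnW n2).
have [i iN [m mN]] := tx 2%N n2.
rewrite /= !in_itv /= expr1 => /andP[y2 _] /andP[_ y1].
have j0 : 0 <= j%:R * e ^+ 4 by apply: mulr_ge0 => //; apply: exprn_ge0; exact: ltW.
have [s s12 bE] := block_start_itv N100 Ne iN.
have /andP[h2 h5] := node_step_itv N100 Ne iN.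
have e50 := exprn_gt0 5 e0.
have mh0 : 0 <= m%:R * node_step e i by apply: mulr_ge0 => //; lra.
have mh : m%:R * node_step e i <= 5 * e ^+ 3.
  have -> : 5 * e ^+ 3 = (N ^ 2)%:R * (5 * e ^+ 5).
    rewrite natrX (_ : _ * (5 * e ^+ 5) = (N%:R * e) ^+ 2 * (5 * e ^+ 3)); last by ring.
    by rewrite Ne expr1n mul1r.
  by apply: ler_pM; rewrite ?ler0n ?ler_nat ?(ltnW mN) //; lra.
have e3 := scale_expr3_le (scale_itv N100 Ne).
have e5 := scale_expr5_le (scale_itv N100 Ne).
have u03 : 0 <= node e i m <= e * 3.
  have : e * 1 <= e * s <= e * 2 by rewrite !ler_pM2l.
  by rewrite /node bE; lra.
have eu : e <= node e i m.
  have : e * 1 <= e * s by rewrite ler_pM2l //; lra.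
  by rewrite /node bE; lra.
have := mulr_itv0 u03 u03; rewrite -expr2.
have : e * 3 * (e * 3) <= e * (9 / 100).
  rewrite (_ : e * 3 * (e * 3) = e * (9 * e)); last by ring.
  by rewrite ler_pM2l //; lra.
move=> u1 u2.
have e6 : e ^+ 6 <= e ^+ 5 by apply: ler_wiXn2l => //; lra.
have tt : e / 4 <= t - t ^+ 2 by lra.
have t20 := sqr_ge0 t.
apply/andP; split; first by lra.
rewrite leNgt; apply/negP => t1.
have : 1 * t < t * t by rewrite ltr_pM2r //; lra.
by rewrite -expr2; lra.
Qed.

Definition test_fun (i : nat) : R -> R := \1_(E i).

Lemma pv_exists_test_fun n x : (2 <= n)%N -> pv_exists (moment_integrand n test_fun x).
Proof.
move=> n2; rewrite moment_integrand_indic.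
apply: pv_exists_indic_inv (hitting_times_itv n2).
- by apply: measurable_hitting_times => i _; exact: measurable_test_set.
by rewrite divr_gt0 // (scale_gt0 N100 Ne).
Qed.

Lemma pv_test_fun_ge n x : (2 <= n)%N -> F x ->
  e ^+ 4 / 3 <= pv (moment_integrand n test_fun x).
Proof.
move=> n2 [i iN]; rewrite /= in_itv /= => xi.
have [c [ec c3 cE]] := window_hits N100 Ne iN xi.
have e0 := scale_gt0 N100 Ne.
have e5 := exprn_gt0 5 e0.
have e40 : 0 < e / 4 by rewrite divr_gt0.
have mS : measurable (hitting_times n E x).
  by apply: measurable_hitting_times => k _; exact: measurable_test_set.
rewrite moment_integrand_indic.
apply: le_trans (le_pv_indic_inv mS e40 (hitting_times_itv n2) (c := c) (d := c + e ^+ 5) _ _ _).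
- rewrite (_ : c + e ^+ 5 - c = e ^+ 5); last by ring.
  rewrite (_ : e ^+ 4 / 3 = e ^+ 5 / (3 * e)).
    by rewrite ler_pM2l // lef_pV2 ?posrE //; lra.
  by field; rewrite gt_eqF.
- by lra.
- by lra.
move=> t; rewrite /= in_itv /= => tc k /andP[k1 _]; exact: cE.
Qed.

End TestSets.

(** * Asymptotics as the scale shrinks *)

Section Asymptotics.
Variable R : realType.

Lemma powR_sum (I : Type) (s : seq I) (P : pred I) (F : I -> R) (b : R) : 0 < b ->
  \prod_(i <- s | P i) b `^ F i = b `^ (\sum_(i <- s | P i) F i).
Proof.
move=> b0; elim/big_rec2: _ => [|i x y _ ->]; first by rewrite powRr0.
by rewrite powRD // (gt_eqF b0) implybT.
Qed.

Lemma exists_scale (g c : R) : 0 < g -> 0 < c ->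
  exists2 N : nat, (100 <= N)%N & (N%:R^-1 : R) `^ g < c.
Proof.
move=> g0 c0.
have : \forall a \near (0 : R)^'+, a `^ g < c.
  by move/cvgr_lt : (powR_cvg0 g0); apply.
move=> [d /= d0 dc].
have [m dm] : exists m : nat, d^-1 < m%:R.
  by exists (Num.bound d^-1); apply: archi_boundP; rewrite invr_ge0 ltW.
exists (maxn 100 m); first exact: leq_maxl.
have M0 : 0 < (maxn 100 m)%:R :> R by rewrite ltr0n leq_max.
apply: dc => /=; last by rewrite invr_gt0.
rewrite sub0r normrN gtr0_norm ?invr_gt0 // -[ltRHS]invrK ltf_pV2 ?posrE ?invr_gt0 //.
by apply: (lt_le_trans dm); rewrite ler_nat leq_maxr.
Qed.

(** The weights [4, 2, 2, 1, 1, ...] exceed [1] by [3, 1, 1, 0, 0, ...]: this is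
    where the exponent [3 / p 1 + 1 / p 2 + 1 / p 3] comes from. *)
Lemma sum_weight (n : nat) (a : nat -> R) : (3 <= n)%N ->
  \sum_(1 <= i < n.+1) (weight i)%:R * a i =
  \sum_(1 <= i < n.+1) a i + (3 * a 1%N + a 2%N + a 3%N).
Proof.
move=> n3; rewrite !(big_ltn (m := 1)) ?(big_ltn (m := 2)) ?(big_ltn (m := 3)) //; try lia.
have -> : \sum_(4 <= i < n.+1) (weight i)%:R * a i = \sum_(4 <= i < n.+1) a i.
  apply: eq_big_nat => i /andP[i4 _]; rewrite /weight ifF; last by apply/negbTE; lia.
  by rewrite ifF ?mul1r //; apply/negbTE; lia.
by rewrite /weight /=; ring.
Qed.

End Asymptotics.

Unset Implicit Arguments.
Set Strict Implicit.

Theorem propositionB4 (R : realType) (n : nat) (p : nat -> R) (r : R)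
  (hn : (4 <= n)%N)
  (hp : forall i : nat, (1 <= i <= n)%N -> 1 < p i)
  (hr : r^-1 = \sum_(1 <= i < n.+1) (p i)^-1)
  (hp123 : 4 < 3 * (p 1%N)^-1 + (p 2%N)^-1 + (p 3%N)^-1) :
  ~ exists C : R, forall f : nat -> R -> R,
      (forall i : nat, (1 <= i <= n)%N ->
         f i \in Lfun (@lebesgue_measure R) (p i)%:E) ->
      {ae @lebesgue_measure R, forall x : R, pv_exists (moment_integrand n f x)} ->
      ('N[@lebesgue_measure R]_(r%:E)[(fun x : R => (pv (moment_integrand n f x))%:E)]
        <= C%:E *
           \prod_(1 <= i < n.+1)
             'N[@lebesgue_measure R]_((p i)%:E)[(fun y : R => (f i y)%:E)])%E.
Proof.
move=> [C hC].
pose rho := \sum_(1 <= i < n.+1) (p i)^-1.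
pose gam := 3 * (p 1%N)^-1 + (p 2%N)^-1 + (p 3%N)^-1 - 4.
have gam0 : 0 < gam by rewrite subr_gt0.
have p0 i : (1 <= i <= n)%N -> 0 < p i by move/hp; apply: lt_trans.
have rho0 : 0 < rho.
  rewrite /rho big_ltn; last by lia.
  apply: ltr_pwDl; first by rewrite invr_gt0 p0 //; lia.
  rewrite big_seq; apply: sumr_ge0 => i; rewrite mem_index_iota => i2.
  by rewrite invr_ge0 ltW // p0 //; lia.
have r0 : 0 < r by rewrite -invr_gt0 hr.
pose K := (`|C| + 1) * 80 `^ rho.
have K0 : 0 < K by rewrite mulr_gt0 ?powR_gt0 // ltr_wpDl.
pose k := 2^-1 `^ rho / 3.
have k0 : 0 < k by rewrite divr_gt0 // powR_gt0 // invr_gt0.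
(* [K] and [k] collect the factors independent of [e]; the inequality would
   give [k <= K * e `^ gam]. *)
have [N N100 Ngam] := exists_scale gam0 (divr_gt0 k0 K0).
pose e : R := N%:R^-1.
have Ne : N%:R * e = 1 by rewrite mulfV // pnatr_eq0; lia.
have e0 := scale_gt0 N100 Ne.
have n2 : (2 <= n)%N by lia.
have mfin i : (lebesgue_measure (test_set e N i) < +oo)%E.
  by apply: le_lt_trans (measure_test_set N100 Ne i) _; rewrite ltry.
have hLfun i : (1 <= i <= n)%N ->
    test_fun e N i \in Lfun (@lebesgue_measure R) (p i)%:E.
  move=> ni; apply: indic_Lfun => //.
  - by rewrite gt_eqF // p0.
  - exact: measurable_test_set.
  exact: mfin.
have hpv : {ae @lebesgue_measure R,
    forall x : R, pv_exists (moment_integrand n (test_fun e N) x)}.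
  by apply: aeW => x; exact: pv_exists_test_fun.
have := hC _ hLfun hpv; apply/negP; rewrite -ltNge.
have lower : ((e ^+ 4 / 3 * (e / 2) `^ rho)%:E <=
    'N[@lebesgue_measure R]_(r%:E)[(fun x : R =>
      (pv (moment_integrand n (test_fun e N) x))%:E)])%E.
  have c0 : 0 < e ^+ 4 / 3 by rewrite divr_gt0 // exprn_gt0.
  have wc x : windows e N x -> e ^+ 4 / 3 <= pv (moment_integrand n (test_fun e N) x).
    exact: pv_test_fun_ge.
  have := @Lnorm_ge_indic _ _ _ (@lebesgue_measure R) r _ _ _ r0 c0
    (measurable_windows e N) wc.
  apply: le_trans; rewrite [X in (_ <= _ * X)%E](_ : _ = ((e / 2) `^ rho)%:E) ?EFinM //.
  by rewrite hr -poweR_EFin; congr poweR; exact: measure_windows.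
apply: lt_le_trans lower.
pose m i := fine (lebesgue_measure (test_set e N i)).
have mE i : lebesgue_measure (test_set e N i) = (m i)%:E.
  by rewrite fineK // ge0_fin_numE.
have normE i : (1 <= i <= n)%N ->
    ('N[@lebesgue_measure R]_((p i)%:E)[(fun y : R => (test_fun e N i y)%:E)])%E
    = (m i `^ (p i)^-1)%:E.
  move=> ni; rewrite Lnorm_indic ?gt_eqF ?p0 //; last exact: measurable_test_set.
  by rewrite -poweR_EFin; congr poweR; exact: mE.
rewrite (eq_big_nat _ _ (F2 := fun i => (m i `^ (p i)^-1)%:E)); last first.
  by move=> i ni; apply: normE; lia.
rewrite prodEFin -EFinM lte_fin.
have bound : \prod_(1 <= i < n.+1) m i `^ (p i)^-1
    <= 80 `^ rho * (e ^+ 4 * e `^ rho * e `^ gam).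
  apply: (@le_trans _ _ (\prod_(1 <= i < n.+1)
      (80 `^ (p i)^-1 * e `^ ((weight i)%:R * (p i)^-1)))).
    rewrite !big_nat; apply: ler_prod => i ni; rewrite powR_ge0 /=.
    have ni' : (1 <= i <= n)%N by lia.
    have e00 := ltW e0; rewrite powRrM powR_mulrn // -powRM ?exprn_ge0 //.
    apply: ge0_ler_powR.
    - by rewrite invr_ge0 ltW // p0.
    - by rewrite nnegrE fine_ge0.
    - by rewrite nnegrE mulr_ge0 // exprn_ge0 // ltW.
    by rewrite -lee_fin -mE measure_test_set.
  rewrite big_split /= !powR_sum // sum_weight //; last by lia.
  rewrite -/rho (_ : _ + _ = 4%:R + rho + gam); last by rewrite /gam; ring.
  have eD u v : e `^ (u + v) = e `^ u * e `^ v by rewrite powRD // (gt_eqF e0) implybT.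
  by rewrite (eD _ gam) (eD _ rho) powR_mulrn // (ltW e0).
have pos : 0 < e ^+ 4 * e `^ rho by rewrite mulr_gt0 ?exprn_gt0 ?powR_gt0.
apply: (@le_lt_trans _ _ ((`|C| + 1) * (80 `^ rho * (e ^+ 4 * e `^ rho * e `^ gam)))).
  apply: le_trans (_ : (`|C| + 1) * \prod_(1 <= i < n.+1) m i `^ (p i)^-1 <= _).
    apply: ler_wpM2r; first by apply: prodr_ge0 => i _; exact: powR_ge0.
    by rewrite (le_trans (ler_norm C)) // lerDl.
  by apply: ler_wpM2l bound; rewrite addr_ge0.
have -> : (`|C| + 1) * (80 `^ rho * (e ^+ 4 * e `^ rho * e `^ gam))
    = e ^+ 4 * e `^ rho * (K * e `^ gam) by rewrite /K; ring.
have -> : e ^+ 4 / 3 * (e / 2) `^ rho = e ^+ 4 * e `^ rho * k.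
  by rewrite powRM ?invr_ge0 ?(ltW e0) // /k; ring.
by rewrite ltr_pM2l // mulrC -ltr_pdivlMr.
Qed.
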